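(* Let $\beta=\beta^{(3)}=\{\beta_{ij}\}_{i,j\in\mathbb{Z}_+,\,0\le i+j\le 3}$ be a real doubly indexed finite sequence with $\beta_{00}>0$, with associated matrices $\mathcal{M}(1)$ and $B(2)$. Suppose that $\mathcal{M}(1)$ is positive semidefinite and $\operatorname{Ran}B(2)\subseteq\operatorname{Ran}\mathcal{M}(1)$. Let $W$ be a real $3\times 3$ matrix with $\mathcal{M}(1)W=B(2)$, and let $b$ be the $(1,3)$ entry and $y$ the $(2,2)$ entry of the symmetric matrix $W^{T}\mathcal{M}(1)W$. If $b=y$, then $\beta$ admits a unique $\operatorname{rank}\mathcal{M}(1)$-atomic representing measure.
   Context: For a real sequence $\beta^{(3)}=\{\beta_{ij}\}_{0\le i+j\le 3}$ set $$\mathcal{M}(1)=\begin{pmatrix}\beta_{00}&\beta_{10}&\beta_{01}\\ \beta_{10}&\beta_{20}&\beta_{11}\\ \beta_{01}&\beta_{11}&\beta_{02}\end{pmatrix},\qquad B(2)=\begin{pmatrix}\beta_{20}&\beta_{11}&\beta_{02}\\ \beta_{30}&\beta_{21}&\beta_{12}\\ \beta_{21}&\beta_{12}&\beta_{03}\end{pmatrix}.$$ $\operatorname{Ran}$ denotes the range (column space) of a matrix. The condition $\operatorname{Ran}B(2)\subseteq\operatorname{Ran}\mathcal{M}(1)$ is equivalent to the existence of $W$ with $\mathcal{M}(1)W=B(2)$, and the matrix $W^{T}\mathcal{M}(1)W$ does not depend on the choice of such $W$. Writing $$W^{T}\mathcal{M}(1)W=\begin{pmatrix}x&a&b\\ a&y&t\\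 b&t&z\end{pmatrix}$$ defines the real numbers $b$ and $y$. A representing measure for $\beta^{(3)}$ is a positive Borel measure $\mu$ on $\mathbb{R}^2$ such that $\beta_{ij}=\int x^iy^j\,d\mu$ for all $i,j\in\mathbb{Z}_+$ with $0\le i+j\le 3$. A measure is $r$-atomic if it has the form $\mu=\sum_{k=1}^{r}\rho_k\delta_{(x_k,y_k)}$ with weights $\rho_k>0$ and $r$ distinct points (atoms) $(x_k,y_k)\in\mathbb{R}^2$. ''Unique'' means that there is exactly one representing measure that is $\operatorname{rank}\mathcal{M}(1)$-atomic. *)

(* Defs.v *)
From mathcomp Require Import all_boot all_order all_algebra.
From mathcomp Require Import all_classical all_reals all_analysis.

Set Implicit Arguments.
Unset Strict Implicit.
Unset Printing Implicit Defensive.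

Import Order.TTheory GRing.Theory Num.Theory.
Import numFieldNormedType.Exports.

Local Open Scope classical_set_scope.
Local Open Scope ring_scope.

(* A sequence {beta_ij}_{0 <= i + j <= 3} is represented by a total function
   beta : nat -> nat -> R; no definition below reads beta i j for i + j > 3. *)

Definition mx_of_rows (R : realType) (m n : nat) (s : seq (seq R)) : 'M[R]_(m, n) :=
  \matrix_(i < m, j < n) nth 0 (nth [::] s i) j.

Definition moment_mx1 (R : realType) (beta : nat -> nat -> R) : 'M[R]_3 :=
  mx_of_rows 3 3
    [:: [:: beta 0 0; beta 1 0; beta 0 1];
        [:: beta 1 0; beta 2 0; beta 1 1];
        [:: beta 0 1; beta 1 1; beta 0 2] ]%N.

Definition moment_B2 (R : realType) (beta : nat -> nat -> R) : 'M[R]_3 :=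
  mx_of_rows 3 3
    [:: [:: beta 2 0; beta 1 1; beta 0 2];
        [:: beta 3 0; beta 2 1; beta 1 2];
        [:: beta 2 1; beta 1 2; beta 0 3] ]%N.

Definition psd (R : realType) (n : nat) (A : 'M[R]_n) : Prop :=
  A^T = A /\ forall v : 'cV[R]_n, 0 <= (v^T *m A *m v) 0 0.

Definition Ran (R : realType) (m n : nat) (A : 'M[R]_(m, n)) : set 'cV[R]_m :=
  range (fun u : 'cV[R]_n => A *m u).

(* The sigma-algebra on the plane is the product of the Borel sigma-algebras
   of the two factors, which is the Borel sigma-algebra of R^2. *)
Notation plane R := (measurableTypeR R * measurableTypeR R)%type.

Definition monomial (R : realType) (i j : nat) (p : plane R) : R :=
  (p.1 : R) ^+ i * (p.2 : R) ^+ j.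

(* Integrability is required so that each moment is a genuine finite integral. *)
Definition representing_measure (R : realType) (beta : nat -> nat -> R)
    (mu : {measure set (plane R) -> \bar R}) : Prop :=
  forall i j : nat, (i + j <= 3)%N ->
    mu.-integrable setT (EFin \o @monomial R i j) /\
    (beta i j)%:E = (\int[mu]_(p in setT) (monomial i j p)%:E)%E.

Definition atomic (R : realType) (r : nat)
    (mu : {measure set (plane R) -> \bar R}) : Prop :=
  exists (rho : 'I_r -> R) (p : 'I_r -> plane R),
    [/\ forall k, 0 < rho k,
        injective p &
        forall A, measurable A -> mu A = (\sum_(k < r) (rho k)%:E * \d_(p k) A)%E].

(* Uniqueness is equality on measurable sets: the library's measures are
   functions on all sets, with unconstrained values on nonmeasurable ones. *)
Definition has_unique_atomic_representing_measure (R : realType)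
    (beta : nat -> nat -> R) (r : nat) : Prop :=
  exists mu : {measure set (plane R) -> \bar R},
    [/\ representing_measure beta mu,
        atomic r mu &
        forall nu : {measure set (plane R) -> \bar R},
          representing_measure beta nu -> atomic r nu ->
          forall A, measurable A -> nu A = mu A].

(* Main.v *)
Require Import Defs.
From mathcomp Require Import all_boot all_order all_algebra.
From mathcomp Require Import all_classical all_reals all_analysis.
From mathcomp Require Import measurable_realfun complex ring.

(* Existence. Factor M(1) = G^T G with G of full row rank r. On R^r, multiplication by x
   and by y (quadratic monomials being reduced by the columns of W) give symmetric
   matrices X and Y, which commute exactly because b = y. Diagonalizing the normal
   matrix X + iY gives r joint eigenvalues in the plane; these are the atoms, weighted by
   the squared moduli of the coordinates of the vector G e_0 representing 1.
   Uniqueness. The matrices (1, x_k, y_k) of two r-atomic representing measures are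
   related by an invertible T; equality of the moments up to degree 3 forces T to
   intertwine the multiplications by the coordinates, so T permutes the atoms. *)

Set Implicit Arguments.
Unset Strict Implicit.
Unset Printing Implicit Defensive.

Import Order.TTheory GRing.Theory Num.Theory.
Import numFieldNormedType.Exports.

Local Open Scope classical_set_scope.
Local Open Scope ring_scope.

(** * Gram factorization of positive semidefinite matrices *)

Lemma block_quadratic_form (R : comPzRingType) n (a c : R) (v : 'rV[R]_n) (N : 'M[R]_n)
    (u : 'cV[R]_n) :
  ((col_mx c%:M u)^T *m block_mx a%:M v v^T N *m col_mx c%:M u) 0 0 =
  a * c ^+ 2 + 2 * c * (v *m u) 0 0 + (u^T *m N *m u) 0 0.
Proof.
rewrite (tr_col_mx c%:M u) mul_row_block mul_row_col tr_scalar_mx.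
rewrite -scalar_mxM !mul_scalar_mx !mulmxDl -scalemxAl !mul_mx_scalar.
have -> : u^T *m v^T = v *m u by rewrite -trmx_mul [v *m u]mx11_scalar tr_scalar_mx.
rewrite !mxE !mulr1n; ring.
Qed.

(** Cholesky factorization by induction on the size: a zero pivot forces its whole row to vanish,
    and a positive pivot leaves a positive semidefinite Schur complement. Row-freeness makes the
    number [s] of rows equal to the rank. *)
Lemma psd_gram (R : rcfType) n (M : 'M[R]_n) :
  M^T = M -> (forall v : 'cV_n, 0 <= (v^T *m M *m v) 0 0) ->
  exists s (G : 'M[R]_(s, n)), row_free G /\ M = G^T *m G.
Proof.
elim: n M => [|n IHn].
  move=> M _ _; exists 0%N, 0; split; first by rewrite /row_free mxrank0.
  by apply/matrixP => -[].
rewrite -[n.+1]/(1 + n)%N => M symM psdM.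
pose a : R := M (lshift n 0) (lshift n 0); pose v := ursubmx M; pose N := drsubmx M.
have defM : M = block_mx a%:M v v^T N.
  rewrite -[LHS]submxK [ulsubmx _]mx11_scalar; congr block_mx; first by rewrite !mxE.
  by rewrite /v trmx_ursub symM.
have symN : N^T = N by rewrite /N trmx_drsub symM.
clearbody a v N.
have formE (c : R) (u : 'cV_n) :
    0 <= a * c ^+ 2 + 2 * c * (v *m u) 0 0 + (u^T *m N *m u) 0 0.
  by have := psdM (col_mx c%:M u); rewrite defM block_quadratic_form.
have a_ge0 : 0 <= a.
  by have := formE 1 0; rewrite !mulmx0 !mxE !mulr0 expr1n mulr1 !addr0.
have [a_le0|a_gt0] := leP a 0.
  have a0 : a = 0 by apply/eqP; rewrite eq_le a_le0.
  have v0 : v = 0.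
    apply/rowP => j; rewrite [RHS]mxE; apply/eqP/contraT => vj_neq0.
    (* With pivot 0 the form is affine in the scalar coordinate; this value of it brings the form
       down to -1. *)
    have := formE (- (N j j + 1) / (2 * v 0 j)) (delta_mx j 0).
    rewrite a0 -colE -mulmxA -colE trmx_delta -rowE !mxE mul0r add0r.
    have -> : 2 * (- (N j j + 1) / (2 * v 0 j)) * v 0 j + N j j = -1.
      by field; rewrite vj_neq0.
    by rewrite oppr_ge0 ler10.
  have [u|s [G [freeG defN]]] := IHn N symN.
    by have := formE 0 u; rewrite expr0n !(mulr0, mul0r) !add0r.
  exists s, (row_mx 0 G); split; first by rewrite /row_free rank_row_0mx.
  by rewrite defM a0 v0 !trmx0 (tr_row_mx 0 G) mul_col_row !trmx0 !mul0mx !mulmx0 -defN raddf0.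
have a_neq0 := lt0r_neq0 a_gt0.
have [||s [G [/row_freeP[H GH] defN]]] := IHn (N - a^-1 *: (v^T *m v)).
- by rewrite linearB linearZ /= trmx_mul trmxK symN.
(* This scalar minimizes the form for fixed [u]; the minimum is the form of the Schur complement at
   [u]. *)
- move=> u; have := formE (- (v *m u) 0 0 / a) u.
  rewrite mulmxBr mulmxBl -scalemxAr -scalemxAl.
  have -> : u^T *m (v^T *m v) *m u = ((v *m u) 0 0 ^+ 2)%:M.
    by rewrite mulmxA -trmx_mul -mulmxA [v *m u]mx11_scalar tr_scalar_mx -scalar_mxM !mxE.
  have -> : a * (- (v *m u) 0 0 / a) ^+ 2 + 2 * (- (v *m u) 0 0 / a) * (v *m u) 0 0 +
            (u^T *m N *m u) 0 0 = (u^T *m N *m u) 0 0 - a^-1 * (v *m u) 0 0 ^+ 2.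
    by field.
  by rewrite !mxE mulr1n.
pose b := Num.sqrt a.
have b_neq0 : b != 0 by rewrite sqrtr_eq0 -ltNge.
exists (1 + s)%N, (block_mx b%:M (b^-1 *: v) 0 G); split.
  apply/row_freeP; exists (block_mx b^-1%:M (- (b^-1 ^+ 2) *: (v *m H)) 0 H).
  rewrite mulmx_block !mul0mx !mulmx0 GH !add0r !addr0 -!scalar_mxM mulfV //.
  rewrite mul_scalar_mx -scalemxAl !scalerA -scalerDl.
  have -> : b * - b^-1 ^+ 2 + b^-1 = 0 by field.
  by rewrite scale0r -scalar_mx_block.
have trZ : (b^-1 *: v)^T = b^-1 *: v^T by rewrite linearZ.
rewrite defM (tr_block_mx b%:M) mulmx_block !trmx0 !mul0mx !mulmx0 !addr0 tr_scalar_mx.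
rewrite -scalar_mxM -expr2 sqr_sqrtr // mul_scalar_mx mul_mx_scalar trZ !scalerA.
rewrite mulfV // !scale1r -defN -scalemxAl -scalemxAr scalerA.
by rewrite -expr2 exprVn sqr_sqrtr // addrC subrK.
Qed.

(** * Joint diagonalization of commuting symmetric matrices *)

Section SpectralTheorem.
Local Open Scope sesquilinear_scope.

(** Commutation makes [Z] = X + iY normal. A unitary diagonalizing [Z] also diagonalizes its
    adjoint, hence X and Y, which are linear combinations of the two; their eigenvalues are the real
    and imaginary parts of those of [Z]. *)
Lemma hermitian_codiagonalization (C : numClosedFieldType) r (X Y : 'M[C]_r) :
  X^t* = X -> Y^t* = Y -> X *m Y = Y *m X ->
  exists U (x y : 'rV[C]_r), [/\ U \is unitarymx, x \is a realmx, y \is a realmx,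
    U *m X = diag_mx x *m U & U *m Y = diag_mx y *m U].
Proof.
move=> hermX hermY comXY.
pose Z := X + 'i *: Y.
have Zadj : Z^t* = X - 'i *: Y.
  rewrite -[in RHS]hermX -[in RHS]hermY; apply/matrixP => i j; rewrite !mxE.
  by rewrite rmorphD rmorphM /= conjCi mulNr.
have normZ : Z \is normalmx.
  apply/normalmxP; rewrite Zadj /Z !mulmxDl !mulmxDr !mulmxN !mulNmx.
  rewrite -!scalemxAl -!scalemxAr comXY.
  by rewrite !addrA addrNK addrK.
have := orthomx_spectralP normZ.
set U := spectralmx Z; set d := spectral_diag Z => defZ.
have unitU : U \is unitarymx := spectral_unitarymx Z.
have UZ : U *m Z = diag_mx d *m U.
  by rewrite {1}defZ !mulmxA mulmxV ?unitarymx_unit // mul1mx.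
have UZ' : U *m Z^t* = diag_mx (map_mx Num.conj d) *m U.
  rewrite {1}defZ invmx_unitary // trmx_mul map_mxM trmx_mul map_mxM trmxCK.
  rewrite tr_diag_mx map_diag_mx !mulmxA.
  by rewrite (unitarymxP unitU) mul1mx.
exists U, (map_mx (fun z : C => 'Re z) d), (map_mx (fun z : C => 'Im z) d); split => //.
- by apply/mxOverP => i j; rewrite mxE Creal_Re.
- by apply/mxOverP => i j; rewrite mxE Creal_Im.
- have -> : X = 2^-1 *: (Z + Z^t*).
    by rewrite Zadj; apply/matrixP => i j; rewrite !mxE; field.
  have -> : map_mx (fun z : C => 'Re z) d = 2^-1 *: (d + map_mx Num.conj d).
    by apply/matrixP => i j; rewrite !mxE ReE mulrC.
  by rewrite -scalemxAr mulmxDr UZ UZ' -mulmxDl -linearD /= scalemxAl -linearZ.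
- have -> : Y = ('i / 2) *: (Z^t* - Z).
    rewrite Zadj; apply/matrixP => i j; rewrite !mxE.
    transitivity (- ('i ^+ 2) * Y i j); last by field.
    by rewrite sqrCi opprK mul1r.
  have -> : map_mx (fun z : C => 'Im z) d = ('i / 2) *: (map_mx Num.conj d - d).
    by apply/matrixP => i j; rewrite !mxE ImE; ring.
  by rewrite -scalemxAr mulmxBr UZ UZ' -mulmxBl -linearB /= scalemxAl -linearZ.
Qed.

(** A finite spectral measure for the vector [g]: over R[i], the weights are the squared moduli of
    the coordinates of [g] in a joint eigenbasis. Weights and eigenvalues are real, so they descend
    to R. *)
Lemma joint_spectral_moments (R : rcfType) r (X Y : 'M[R]_r) (g : 'cV[R]_r) :
  X^T = X -> Y^T = Y -> X *m Y = Y *m X ->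
  exists x y rho : 'I_r -> R,
    (forall k, 0 <= rho k) /\
    forall i j, (g^T *m X ^+ i *m Y ^+ j *m g) 0 0 =
                \sum_k rho k * (x k ^+ i * y k ^+ j).
Proof.
move=> symX symY comXY.
pose toC m n (A : 'M[R]_(m, n)) := map_mx (real_complex R) A.
have toC_adj m n (A : 'M[R]_(m, n)) : (toC _ _ A)^t* = toC _ _ A^T.
  by apply/matrixP => i j; rewrite !mxE -[RHS](@conjc_real R).
have toCM m n p (A : 'M[R]_(m, n)) (B : 'M[_]_(n, p)) : toC _ _ (A *m B) = toC _ _ A *m toC _ _ B.
  exact: map_mxM.
have [||| U [x [y [unitU realx realy UX UY]]]] :=
    @hermitian_codiagonalization _ r (toC _ _ X) (toC _ _ Y).
- by rewrite toC_adj symX.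
- by rewrite toC_adj symY.
- by rewrite -!toCM comXY.
pose v := U *m toC _ _ g.
have Uw i j : U *m toC _ _ (X ^+ i *m Y ^+ j *m g) =
    \col_k (x 0 k ^+ i * y 0 k ^+ j * v k 0).
  elim: i => [|i IHi].
    rewrite mul1mx; elim: j => [|j IHj].
      by rewrite mul1mx; apply/colP => k; rewrite !mxE !mul1r.
    rewrite exprS -mulmxE -mulmxA toCM mulmxA UY -mulmxA IHj.
    by apply/colP => k; rewrite mul_diag_mx !mxE exprS; ring.
  have -> : X ^+ i.+1 *m Y ^+ j *m g = X *m (X ^+ i *m Y ^+ j *m g).
    by rewrite exprS -mulmxE !mulmxA.
  rewrite toCM mulmxA UX -mulmxA IHi.
  by apply/colP => k; rewrite mul_diag_mx !mxE exprS; ring.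
pose re (z : R[i]) := complex.Re z.
exists (fun k => re (x 0 k)), (fun k => re (y 0 k)), (fun k => re (`|v k 0| ^+ 2)).
have reK z : z \is Num.real -> (re z)%:C%C = z.
  by move=> z_real; rewrite complexRe; apply/Creal_ReP.
split.
  by move=> k; rewrite -lecR reK; [exact: exprn_ge0 | exact/ger0_real/exprn_ge0].
move=> i j; apply: (@complexI R).
have -> : g^T *m X ^+ i *m Y ^+ j *m g = g^T *m (X ^+ i *m Y ^+ j *m g).
  by rewrite !mulmxA.
have -> (A : 'M[R]_1) : ((A 0 0)%:C)%C = toC _ _ A 0 0 by rewrite mxE.
have -> : toC _ _ (g^T *m (X ^+ i *m Y ^+ j *m g)) =
    v^t* *m \col_k (x 0 k ^+ i * y 0 k ^+ j * v k 0).
  (* Unitarity allows inserting U^* U next to [g], so the form is computed in eigencoordinates. *)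
  rewrite -Uw /v trmx_mul map_mxM toC_adj toCM.
  rewrite -!mulmxA (mulmxA (U ^t*)) -(invmx_unitary unitU) mulVmx ?unitarymx_unit //.
  by rewrite mul1mx !toCM.
rewrite mxE rmorph_sum; apply: eq_bigr => k _.
have vk_real : `|v k 0| ^+ 2 \is Num.real by exact/ger0_real/exprn_ge0.
have xk_real := mxOverP realx 0 k; have yk_real := mxOverP realy 0 k.
rewrite [X in X * _]mxE [X in X ^*]mxE [X in _ * X]mxE.
rewrite -{1}(reK _ xk_real) -{1}(reK _ yk_real).
transitivity ((re (`|v k 0| ^+ 2))%:C * ((re (x 0 k))%:C ^+ i * (re (y 0 k))%:C ^+ j))%C.
  by rewrite (reK _ vk_real) normCK; ring.
by rewrite !rmorphM !rmorphXn.
Qed.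

End SpectralTheorem.

(** * Moment matrices of atomic families, and uniqueness of the atoms *)

Section AtomMatrices.
Variables (F : fieldType) (r : nat).
Implicit Types (beta : nat -> nat -> F) (rho x y : 'I_r -> F).

Definition atomic_moments beta rho x y : Prop :=
  forall i j, (i + j <= 3)%N -> beta i j = \sum_k rho k * (x k ^+ i * y k ^+ j).

(* The rows and columns are indexed by the monomials 1, x, y, so that
   [localizing_mx beta 0 0] is M(1). *)
Definition localizing_mx beta (i j : nat) : 'M[F]_3 :=
  \matrix_(a < 3, b < 3) beta (i + ((a == 1 :> nat) + (b == 1 :> nat)))%N
                              (j + ((a == 2 :> nat) + (b == 2 :> nat)))%N.

(** The Vandermonde-type matrix evaluating 1, x, y at the points. *)
Definition atom_mx x y : 'M[F]_(r, 3) :=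
  \matrix_(k < r, a < 3) (x k ^+ (a == 1 :> nat) * y k ^+ (a == 2 :> nat)).

Definition diag_fun (w : 'I_r -> F) : 'M[F]_r := diag_mx (\row_k w k).

(** The entries are moments of degree at most i + j + 2, so i + j <= 1 keeps them within the known
    degree 3. *)
Lemma localizing_atomic beta rho x y i j : atomic_moments beta rho x y ->
  (i + j <= 1)%N ->
  localizing_mx beta i j = (atom_mx x y)^T *m
    diag_fun (fun k => rho k * (x k ^+ i * y k ^+ j)) *m atom_mx x y.
Proof.
move=> mom ij; apply/matrixP => a b; rewrite !mxE mom; last first.
  by case: a b ij => [[|[|[|a]]] //= _] [[|[|[|b]]] //= _]; case: i j => [|[|i]] [|[|j]].
apply: eq_bigr => k _; rewrite mul_mx_diag !mxE !exprD; ring.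
Qed.

Lemma atom_mx_inj x y : row_free (atom_mx x y) -> injective (fun k => (x k, y k)).
Proof.
move=> /row_freeP[B PB] k l [xkl ykl].
have := congr1 (fun A => row k A *m delta_mx k 0 : 'M[_]_1) PB.
have -> : row k (atom_mx x y *m B) = row l (atom_mx x y *m B).
  by rewrite !row_mul; congr (_ *m _); apply/rowP => a; rewrite !mxE xkl ykl.
rewrite PB -!colE => /matrixP/(_ 0 0); rewrite !mxE eqxx.
by case: eqVneq => [->//|_] /eqP; rewrite eq_sym oner_eq0.
Qed.

(** In the factorization P^T D P of M(1), each factor has rank at least that of the product, which
    is r; thus P has full row rank and the diagonal D is invertible. *)
Lemma atomic_full_rank beta rho x y : atomic_moments beta rho x y ->
  \rank (localizing_mx beta 0 0) = r ->
  row_free (atom_mx x y) /\ forall k, rho k != 0.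
Proof.
move=> mom rk; have defM := localizing_atomic (i := 0) (j := 0) mom isT; split.
  rewrite /row_free eqn_leq rank_leq_row /= -[leqLHS]rk defM; exact: mxrankM_maxr.
move=> k; pose w k := rho k * (x k ^+ 0 * y k ^+ 0).
have : row_free (diag_fun w).
  rewrite /row_free eqn_leq rank_leq_row /= -[leqLHS]rk defM.
  exact: leq_trans (mxrankM_maxl _ _) (mxrankM_maxr _ _).
rewrite row_free_unit unitmxE det_diag unitfE => /prodf_neq0 /(_ k isT).
by rewrite mxE /w !mulr1.
Qed.

Lemma diag_funM (v w : 'I_r -> F) : diag_fun (fun k => v k * w k) = diag_fun v *m diag_fun w.
Proof. by rewrite mulmx_diag; congr diag_mx; apply/rowP => k; rewrite !mxE. Qed.

Lemma atomic_moments_unique beta rho x y sigma x' y' :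
  atomic_moments beta rho x y -> atomic_moments beta sigma x' y' ->
  \rank (localizing_mx beta 0 0) = r ->
  exists f : 'I_r -> 'I_r, [/\ bijective f, forall k, sigma k = rho (f k),
    forall k, x' k = x (f k) & forall k, y' k = y (f k)].
Proof.
move=> mom mom' rk.
have [freeP rho0] := atomic_full_rank mom rk.
have [freeQ sigma0] := atomic_full_rank mom' rk.
have Pinj := atom_mx_inj freeP; have Qinj := atom_mx_inj freeQ.
set P := atom_mx x y in freeP Pinj; set Q := atom_mx x' y' in freeQ Qinj.
have /row_freeP[P' PP'] := freeP; have /row_freeP[Q' QQ'] := freeQ.
(* Full row rank of P allows cancelling P^T on the left and P on the right. *)
have PTK m (A B : 'M[_]_(r, m)) : P^T *m A = P^T *m B -> A = B.
  move=> /(congr1 (mulmx P'^T)); rewrite !mulmxA -!trmx_mul PP' trmx1.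
  by rewrite !mul1mx.
have PK m (A B : 'M[_]_(m, r)) : A *m P = B *m P -> A = B.
  by move=> /(congr1 (mulmx^~ P')); rewrite -!mulmxA PP' !mulmx1.
have eqL i j : (i + j <= 1)%N ->
    P^T *m (diag_fun rho *m diag_fun (fun k => x k ^+ i * y k ^+ j)) *m P =
    Q^T *m (diag_fun sigma *m diag_fun (fun k => x' k ^+ i * y' k ^+ j)) *m Q.
  move=> ij; rewrite -!diag_funM.
  by rewrite -(localizing_atomic mom ij) -(localizing_atomic mom' ij).
have diag1 (u v : 'I_r -> F) : diag_fun (fun k => u k ^+ 0 * v k ^+ 0) = 1%:M.
  by rewrite /diag_fun -diag_const_mx; congr diag_mx; apply/rowP => k; rewrite !mxE mul1r.
have eqM := eqL 0%N 0%N isT; rewrite !diag1 !mulmx1 in eqM.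
(* Obtained by solving P^T D_rho P = Q^T D_sigma Q for Q: multiply by Q'^T on the left, then invert
   D_sigma. *)
pose T := diag_fun (fun k => (sigma k)^-1) *m (Q'^T *m P^T *m diag_fun rho).
have QT : Q = T *m P.
  rewrite /T -mulmxA -(mulmxA Q'^T) -mulmxA eqM !mulmxA -(mulmxA _ Q'^T) -trmx_mul QQ'.
  rewrite trmx1 mulmx1 -diag_funM.
  have -> : diag_fun (fun k => (sigma k)^-1 * sigma k) = 1%:M.
    rewrite /diag_fun -diag_const_mx; congr diag_mx; apply/rowP => k.
    by rewrite !mxE mulVf.
  by rewrite mul1mx.
have unitT : T \in unitmx.
  rewrite -row_free_unit /row_free eqn_leq rank_leq_row /=.
  rewrite -[leqLHS](eqP freeQ) QT; exact: mxrankM_maxl.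
clearbody T.
have eqL' i j : (i + j <= 1)%N ->
    diag_fun rho *m diag_fun (fun k => x k ^+ i * y k ^+ j) =
    T^T *m (diag_fun sigma *m diag_fun (fun k => x' k ^+ i * y' k ^+ j)) *m T.
  move=> ij; apply: PK; apply: PTK; rewrite mulmxA eqL // QT trmx_mul.
  by rewrite !mulmxA.
have eqD : diag_fun rho = T^T *m diag_fun sigma *m T.
  by have := eqL' 0%N 0%N isT; rewrite !diag1 !mulmx1.
have unitTS : T^T *m diag_fun sigma \in unitmx.
  rewrite unitmx_mul unitmx_tr unitT /= unitmxE det_diag unitfE.
  by apply/prodf_neq0 => k _; rewrite mxE.
(* Writing D_rho as T^T D_sigma T and cancelling T^T D_sigma leaves T D = D' T, with D and D' the
   diagonal matrices of the monomial at the two families of points; entry (k, l) gives the claim. *)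
have intertw i j k l : (i + j <= 1)%N -> T k l != 0 ->
    x l ^+ i * y l ^+ j = x' k ^+ i * y' k ^+ j.
  move=> ij Tkl; have := eqL' i j ij; rewrite eqD -!mulmxA !(mulmxA T^T).
  move=> /(can_inj (mulKmx unitTS)) /matrixP /(_ k l).
  rewrite mul_mx_diag mul_diag_mx !mxE mulrC => /mulIf -> //.
have Tpt k l : T k l != 0 -> (x' k, y' k) = (x l, y l).
  move=> Tkl; have := intertw 1%N 0%N k l isT Tkl; have := intertw 0%N 1%N k l isT Tkl.
  by rewrite !expr0 !expr1 !mul1r !mulr1 => -> ->.
have exT k : exists l, T k l != 0.
  apply/existsP/contraT; rewrite negb_exists => /forallP T0.
  have : delta_mx 0 k *m T = 0 :> 'rV_r.
    by rewrite -rowE; apply/rowP => l; rewrite !mxE; apply/eqP/negPn/T0.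
  move/(congr1 (mulmx^~ (invmx T))); rewrite mulmxK // mul0mx.
  by move=> /matrixP/(_ 0 k)/eqP; rewrite !mxE !eqxx oner_eq0.
pose f k := xchoose (exT k).
have fP k : T k (f k) != 0 := xchooseP (exT k).
have f_inj : injective f.
  by move=> k l fkl; apply: Qinj; rewrite /= (Tpt _ _ (fP k)) (Tpt _ _ (fP l)) fkl.
(* Distinctness of the points leaves one nonzero entry in row k of T; the column of the constant
   monomial in Q = T P shows that it is 1. *)
have Tf k l : T k l = (l == f k)%:R.
  have T0 m : m != f k -> T k m = 0.
    apply: contraNeq => Tkm; apply/eqP; apply: Pinj => /=.
    by rewrite -(Tpt _ _ Tkm) -(Tpt _ _ (fP k)).
  have [->|/T0//] := eqVneq l (f k).
  have /matrixP/(_ k 0) := QT; rewrite !mxE (bigD1 (f k)) //= big1.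
    by rewrite !mxE /= !mulr1 addr0.
  by move=> m /T0 ->; rewrite mul0r.
exists f; split; first exact: injF_bij.
- move=> k; have /matrixP/(_ (f k) (f k)) := eqD.
  rewrite mul_mx_diag !mxE eqxx mulr1n (bigD1 k) //= big1 => [|l lk].
    by rewrite !mxE !Tf eqxx mul1r mulr1 addr0.
  by rewrite !mxE !Tf (inj_eq f_inj) eq_sym (negPf lk) mulr0.
- by move=> k; have [-> _] := Tpt _ _ (fP k).
- by move=> k; have [_ ->] := Tpt _ _ (fP k).
Qed.

End AtomMatrices.

(** * Commuting multiplication operators and existence of the atoms *)

(** With H a right inverse of G, take X = G Nx H and Y = G Ny H. Symmetry of G^T G Nx turns X into
    H^T Nx^T G^T, so X is symmetric; similarly for Y. Then X Y and Y X are the two sides of the last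
    hypothesis between H^T and H. *)
Lemma localizing_comm_operators (F : fieldType) n r (G : 'M[F]_(r, n)) (Nx Ny : 'M[F]_n) :
  row_free G ->
  (G^T *m G *m Nx)^T = G^T *m G *m Nx ->
  (G^T *m G *m Ny)^T = G^T *m G *m Ny ->
  Nx^T *m (G^T *m G) *m Ny = Ny^T *m (G^T *m G) *m Nx ->
  exists X Y : 'M[_]_r, [/\ X^T = X, Y^T = Y, X *m Y = Y *m X,
    X *m G = G *m Nx & Y *m G = G *m Ny].
Proof.
move=> /row_freeP[H GH] symLx symLy comN.
have HG : H^T *m G^T = 1%:M by rewrite -trmx_mul GH trmx1.
have opE N : (G^T *m G *m N)^T = G^T *m G *m N ->
    [/\ (G *m N *m H)^T = G *m N *m H, G *m N *m H = H^T *m N^T *m G^T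
      & G *m N *m H *m G = G *m N].
  move=> symL.
  have symN : N^T *m G^T *m G = G^T *m G *m N by rewrite -symL !trmx_mul trmxK mulmxA.
  have XE : G *m N *m H = H^T *m N^T *m G^T.
    rewrite -[LHS]mul1mx -HG -!mulmxA (mulmxA G^T) (mulmxA (G^T *m G)) -symN.
    by rewrite -!mulmxA GH mulmx1.
  split=> //; first by rewrite {1}XE !trmx_mul !trmxK mulmxA.
  rewrite XE -mulmxA -[_ *m N^T *m _]mulmxA (mulmxA N^T) symN.
  by rewrite !mulmxA HG mul1mx.
have [symX XE XG] := opE _ symLx; have [symY YE YG] := opE _ symLy.
exists (G *m Nx *m H), (G *m Ny *m H); split=> //.
rewrite {1}XE [in RHS]YE.
transitivity (H^T *m (Nx^T *m (G^T *m G) *m Ny) *m H); first by rewrite !mulmxA.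
by rewrite comN !mulmxA.
Qed.

(** Collects the exponents when entry (a, b) of G^T X^i Y^j G is read as a moment: the outer factors
    come from columns a and b of G. *)
Lemma commr_monomialM (A : pzRingType) (X Y : A) a1 a2 i j b1 b2 : GRing.comm X Y ->
  Y ^+ a2 * X ^+ a1 * (X ^+ i * Y ^+ j) * (X ^+ b1 * Y ^+ b2) =
  X ^+ (i + (a1 + b1)) * Y ^+ (j + (a2 + b2)).
Proof.
move=> comXY.
have c p q : Y ^+ p * X ^+ q = X ^+ q * Y ^+ p.
  by apply: commrX; apply/commr_sym/commrX.
transitivity (Y ^+ a2 * X ^+ (a1 + i + b1) * Y ^+ (j + b2)).
  by rewrite !exprD -!mulrA (mulrA (Y ^+ j)) (c j) -mulrA.
by rewrite c -mulrA -exprD -addnA (addnCA a1) (addnCA a2).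
Qed.

Section Existence.
Variables (R : rcfType) (beta : nat -> nat -> R).
Let M := localizing_mx beta 0 0.

(** [Nx] and [Ny] act as multiplication by x and y on the span of 1, x, y; the conditions on their
    first columns say that they send 1 to x and to y. *)
Lemma atomic_moments_exist (Nx Ny : 'M[R]_3) :
  (forall v : 'cV_3, 0 <= (v^T *m M *m v) 0 0) ->
  M *m Nx = localizing_mx beta 1 0 -> M *m Ny = localizing_mx beta 0 1 ->
  col 0 Nx = delta_mx 1 0 -> col 0 Ny = delta_mx 2 0 ->
  Nx^T *m M *m Ny = Ny^T *m M *m Nx ->
  exists rho x y : 'I_(\rank M) -> R,
    (forall k, 0 < rho k) /\ atomic_moments beta rho x y.
Proof.
move=> psdM MNx MNy Nx0 Ny0 comN.
have symL i j : (localizing_mx beta i j)^T = localizing_mx beta i j.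
  by apply/matrixP => a b; rewrite !mxE (addnC (a == 1 :> nat)) (addnC (a == 2 :> nat)).
have [s [G [freeG defM]]] := @psd_gram R 3 M (symL 0%N 0%N) psdM.
have rkM : \rank M = s by rewrite defM mxrankMfree // mxrank_tr; apply/eqP.
rewrite rkM.
have [||| X [Y [symX symY comXY XG YG]]] :=
    @localizing_comm_operators _ _ _ G Nx Ny freeG.
- by rewrite -defM MNx.
- by rewrite -defM MNy.
- by rewrite -defM.
have [x [y [rho [rho_ge0 momE]]]] := joint_spectral_moments (col 0 G) symX symY comXY.
have comXYr : GRing.comm X Y by [].
(* The columns of G represent 1, x, y, so the last two are X and Y applied to the first. *)
have colG (a : 'I_3) : col a G = X ^+ (a == 1 :> nat) *m Y ^+ (a == 2 :> nat) *m col 0 G.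
  case: a => [[|[|[|//]]] a3] /=; rewrite ?expr0 ?expr1 ?mulmx1 ?mul1mx.
  - by congr col; apply: val_inj.
  - rewrite !colE mulmxA XG -mulmxA -(colE 0 Nx) Nx0.
    by congr (_ *m delta_mx _ _); apply: val_inj.
  - rewrite !colE mulmxA YG -mulmxA -(colE 0 Ny) Ny0.
    by congr (_ *m delta_mx _ _); apply: val_inj.
have symXn (A : 'M[R]_s) n : A^T = A -> (A ^+ n)^T = A ^+ n.
  move=> symA; elim: n => [|n IHn]; first exact: trmx1.
  by rewrite exprS trmx_mul IHn symA mulmxE -exprSr exprS.
have trG (a : 'I_3) :
    (col a G)^T = (col 0 G)^T *m (Y ^+ (a == 2 :> nat) *m X ^+ (a == 1 :> nat)).
  by rewrite {1}colG trmx_mul trmx_mul (symXn X _ symX) (symXn Y _ symY).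
have locE i j : localizing_mx beta i j = G^T *m (X ^+ i *m Y ^+ j) *m G ->
  forall a b : 'I_3,
    beta (i + ((a == 1 :> nat) + (b == 1 :> nat)))%N (j + ((a == 2 :> nat) + (b == 2 :> nat)))%N =
    \sum_k rho k * (x k ^+ (i + ((a == 1 :> nat) + (b == 1 :> nat)))
                  * y k ^+ (j + ((a == 2 :> nat) + (b == 2 :> nat)))).
  move=> locE a b; rewrite -momE.
  have := congr1 (fun A : 'M[_]_3 => A a b) locE; rewrite mxE => ->.
  have -> (A : 'M[_]_s) : (G^T *m A *m G) a b = ((col a G)^T *m A *m col b G) 0 0.
    by rewrite tr_col -row_mul [col b G]colE mulmxA -row_mul -colE !mxE.
  rewrite [col b G]colG [(col a G)^T]trG.
  move: (nat_of_bool (a == 1)) (nat_of_bool (a == 2)) => a1 a2.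
  move: (nat_of_bool (b == 1)) (nat_of_bool (b == 2)) => b1 b2.
  have e := commr_monomialM a1 a2 i j b1 b2 comXYr.
  transitivity (((col 0 G)^T *m (Y ^+ a2 * X ^+ a1 * (X ^+ i * Y ^+ j) *
    (X ^+ b1 * Y ^+ b2)) *m col 0 G) 0 0).
    by rewrite -!mulmxE !mulmxA.
  by rewrite e -mulmxE !mulmxA.
have loc00 : localizing_mx beta 0 0 = G^T *m (X ^+ 0 *m Y ^+ 0) *m G.
  by rewrite !expr0 !mulmx1 -defM.
have loc10 : localizing_mx beta 1 0 = G^T *m (X ^+ 1 *m Y ^+ 0) *m G.
  by rewrite expr0 expr1 mulmx1 -mulmxA XG mulmxA -defM MNx.
have loc01 : localizing_mx beta 0 1 = G^T *m (X ^+ 0 *m Y ^+ 1) *m G.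
  by rewrite expr0 expr1 mul1mx -mulmxA YG mulmxA -defM MNy.
have mom : atomic_moments beta rho x y.
  (* Degrees up to 2 are entries of M(1); the cubic moments come from the matrix localized at x,
     except [beta 0 3], taken from the one at y. *)
  move=> [|[|[|[|i]]]] [|[|[|[|j]]]] // _; rewrite ?addnS //.
  - exact: (locE _ _ loc00 0 0).
  - exact: (locE _ _ loc00 0 2).
  - exact: (locE _ _ loc00 2 2).
  - exact: (locE _ _ loc01 2 2).
  - exact: (locE _ _ loc00 0 1).
  - exact: (locE _ _ loc00 1 2).
  - exact: (locE _ _ loc10 2 2).
  - exact: (locE _ _ loc00 1 1).
  - exact: (locE _ _ loc10 1 2).
  - exact: (locE _ _ loc10 1 1).
(* There are only rank M(1) points, so no weight can vanish. *)
exists rho, x, y; split=> // k; rewrite lt_def rho_ge0 andbT.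
exact: (atomic_full_rank mom rkM).2.
Qed.

End Existence.

(** * Finitely atomic measures and their integrals *)

Section FiniteAtomicMeasure.
Variables (d : measure_display) (T : measurableType d) (R : realType) (r : nat).
Variables (rho : 'I_r -> {nonneg R}) (p : 'I_r -> T).

(** Indexed by all naturals to fit [msum], with the zero measure from index r on. *)
Definition weighted_dirac (k : nat) : {measure set T -> \bar R} :=
  if insub k is Some i then mscale (rho i) (dirac (p i)) else mzero.

Definition finite_atomic : {measure set T -> \bar R} := msum weighted_dirac r.

Lemma finite_atomicE A : finite_atomic A = (\sum_(k < r) ((rho k)%:num)%:E * \d_(p k) A)%E.
Proof.
rewrite /finite_atomic /= /msum; apply: eq_bigr => k _.
by rewrite /weighted_dirac valK.
Qed.

Lemma ge0_integral_finite_atomic (f : T -> \bar R) :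
  measurable_fun setT f -> (forall x, 0 <= f x)%E ->
  (\int[finite_atomic]_x f x = \sum_(k < r) ((rho k)%:num)%:E * f (p k))%E.
Proof.
move=> mf f0; rewrite ge0_integral_measure_sum//; apply: eq_bigr => k _.
rewrite /weighted_dirac valK ge0_integral_mscale//.
by rewrite integral_dirac// diracT mul1e.
Qed.

Lemma integral_finite_atomic (f : T -> R) : measurable_fun setT f ->
  (\int[finite_atomic]_x (f x)%:E = (\sum_(k < r) (rho k)%:num * f (p k))%:E)%E.
Proof.
move=> mf; rewrite integralE.
have mf' : measurable_fun setT (EFin \o f) by exact/measurable_EFinP.
rewrite !ge0_integral_finite_atomic //; last 2 first.
- exact: measurable_funeneg.
- exact: measurable_funepos.
rewrite -[fun x => (f x)%:E]/(EFin \o f) funerpos funerneg /=.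
under eq_bigr do rewrite -EFinM.
under [in X in (_ - X)%E]eq_bigr do rewrite -EFinM.
rewrite !sumEFin -EFinB -sumrB; congr (_%:E); apply: eq_bigr => k _.
by rewrite -mulrBr -[in RHS](funrposBneg f).
Qed.

(** For measurable f, the integral of |f| is finite exactly when that of f is, and the latter is a
    finite real sum. *)
Lemma integrable_finite_atomic (f : T -> R) : measurable_fun setT f ->
  finite_atomic.-integrable setT (EFin \o f).
Proof.
move=> mf; apply/integrableP; split; first exact/measurable_EFinP.
by rewrite /= integral_fin_num_abs// integral_finite_atomic.
Qed.

End FiniteAtomicMeasure.

Lemma measurable_monomial (R : realType) i j : measurable_fun setT (@monomial R i j).
Proof.
apply: measurable_funM; apply: measurable_funX; [exact: measurable_fst|exact: measurable_snd].
Qed.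

(** * Multiplication by the coordinates, as encoded by W *)

Lemma ord3_ind (P : 'I_3 -> Prop) : P 0 -> P 1 -> P 2 -> forall a, P a.
Proof.
move=> P0 P1 P2 [[|[|[|//]]] a3].
- by rewrite (_ : Ordinal a3 = 0) //; apply: val_inj.
- by rewrite (_ : Ordinal a3 = 1) //; apply: val_inj.
- by rewrite (_ : Ordinal a3 = 2) //; apply: val_inj.
Qed.

Section FlatExtension.
Variables (R : realType) (beta : nat -> nat -> R) (W : 'M[R]_3).
Let M := moment_mx1 beta.
Hypothesis M1_W : M *m W = moment_B2 beta.

Lemma moment_mx1E : M = localizing_mx beta 0 0.
Proof. by apply/matrixP; elim/ord3_ind; elim/ord3_ind; rewrite !mxE. Qed.

(* Multiplication by x (by y) from affine to quadratic polynomials, followed by the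
   reduction of degree 2 monomials to affine polynomials given by the columns of [W]. *)
Definition mulX_mx : 'M[R]_3 := \matrix_(a, b)
  nth 0 [:: (a == 1)%:R; W a 0; W a 1] b.
Definition mulY_mx : 'M[R]_3 := \matrix_(a, b)
  nth 0 [:: (a == 2)%:R; W a 1; W a 2] b.

Let colX0 : col 0 mulX_mx = delta_mx 1 0.
Proof. by apply/colP => a; rewrite !mxE andbT. Qed.
Let colX1 : col 1 mulX_mx = col 0 W. Proof. by apply/colP => a; rewrite !mxE. Qed.
Let colX2 : col 2 mulX_mx = col 1 W. Proof. by apply/colP => a; rewrite !mxE. Qed.
Let colY0 : col 0 mulY_mx = delta_mx 2 0.
Proof. by apply/colP => a; rewrite !mxE andbT. Qed.
Let colY1 : col 1 mulY_mx = col 1 W. Proof. by apply/colP => a; rewrite !mxE. Qed.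
Let colY2 : col 2 mulY_mx = col 2 W. Proof. by apply/colP => a; rewrite !mxE. Qed.

Let M_colW j : M *m col j W = col j (moment_B2 beta).
Proof. by rewrite -M1_W !colE mulmxA. Qed.

Let col_inj (A B : 'M[R]_3) : (forall b, col b A = col b B) -> A = B.
Proof. by move=> eqAB; apply/matrixP => a b; have /colP/(_ a) := eqAB b; rewrite !mxE. Qed.

(** The first column selects the x column of M(1); the other two give the x^2 and xy columns of
    B(2), by the equation for W. *)
Lemma mulmx_mulX : M *m mulX_mx = localizing_mx beta 1 0.
Proof.
apply: col_inj => b; rewrite colE -mulmxA -colE.
elim/ord3_ind: b; rewrite ?colX0 ?colX1 ?colX2 ?M_colW -?colE;
  by apply/colP; elim/ord3_ind; rewrite !mxE.
Qed.

Lemma mulmx_mulY : M *m mulY_mx = localizing_mx beta 0 1.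
Proof.
apply: col_inj => b; rewrite colE -mulmxA -colE.
elim/ord3_ind: b; rewrite ?colY0 ?colY1 ?colY2 ?M_colW -?colE;
  by apply/colP; elim/ord3_ind; rewrite !mxE.
Qed.

(** Entries in the first row or column agree because the cubic moments repeat in B(2), and diagonal
    ones by symmetry of M(1). The remaining entries (1, 2) and (2, 1) compare exactly b with y. *)
Lemma mulXY_comm : (W^T *m M *m W) 0 2 = (W^T *m M *m W) 1 1 ->
  mulX_mx^T *m M *m mulY_mx = mulY_mx^T *m M *m mulX_mx.
Proof.
move=> b_eq_y.
have symM : M^T = M by apply/matrixP; elim/ord3_ind; elim/ord3_ind; rewrite !mxE.
pose q (u v : 'cV_3) := (u^T *m M *m v) 0 0.
have qC u v : q u v = q v u.
  rewrite /q; have -> : u^T *m M *m v = (v^T *m M *m u)^T; last by rewrite mxE.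
  by rewrite !trmx_mul trmxK symM mulmxA.
have qE A B a b : (A^T *m M *m B) a b = q (col a A) (col b B).
  by rewrite /q tr_col -row_mul [col b B]colE mulmxA -row_mul -colE !mxE.
have qdW i j : q (delta_mx i 0) (col j W) = moment_B2 beta i j.
  by rewrite /q -mulmxA M_colW trmx_delta -rowE !mxE.
rewrite !qE in b_eq_y.
have sym01 : q (delta_mx 1 0) (col 1 W) = q (delta_mx 2 0) (col 0 W).
  by rewrite !qdW !mxE.
have sym02 : q (delta_mx 1 0) (col 2 W) = q (delta_mx 2 0) (col 1 W).
  by rewrite !qdW !mxE.
apply/matrixP; elim/ord3_ind; elim/ord3_ind;
  rewrite !qE ?colX0 ?colX1 ?colX2 ?colY0 ?colY1 ?colY2 //.
- by rewrite [RHS]qC sym01 qC.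
- by rewrite [RHS]qC sym02 qC.
- by rewrite [RHS]qC b_eq_y.
Qed.

End FlatExtension.

(** * Existence and uniqueness of the representing measure *)

Theorem theorem3p3 (R : realType) (beta : nat -> nat -> R)
    (beta00_gt0 : 0 < beta 0%N 0%N)
    (M1_psd : psd (moment_mx1 beta))
    (B2_sub_M1 : Ran (moment_B2 beta) `<=` Ran (moment_mx1 beta))
    (W : 'M[R]_3) (M1_W : moment_mx1 beta *m W = moment_B2 beta)
    (b_eq_y : (W^T *m moment_mx1 beta *m W) 0 2 =
              (W^T *m moment_mx1 beta *m W) 1 1) :
  has_unique_atomic_representing_measure beta (\rank (moment_mx1 beta)).
Proof.
have [_ psdM] := M1_psd.
have defM := moment_mx1E beta.
have [rho [x [y [rho_gt0 mom]]]] : exists rho x y : 'I_(\rank (moment_mx1 beta)) -> R,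
    (forall k, 0 < rho k) /\ atomic_moments beta rho x y.
  have := mulmx_mulX M1_W; have := mulmx_mulY M1_W; have := mulXY_comm M1_W b_eq_y.
  rewrite defM in psdM * => comN MNy MNx.
  apply: (atomic_moments_exist psdM MNx MNy) => //.
  - by apply/colP => a; rewrite !mxE andbT.
  - by apply/colP => a; rewrite !mxE andbT.
set r := \rank _ in rho x y rho_gt0 mom *.
have rk : \rank (localizing_mx beta 0 0) = r by rewrite -defM.
have [freeP _] := atomic_full_rank mom rk.
exists (finite_atomic (fun k => NngNum (ltW (rho_gt0 k))) (fun k => (x k, y k) : plane R)).
split.
- move=> i j ij; split.
    apply: integrable_finite_atomic; exact: measurable_monomial.
  by rewrite (integral_finite_atomic _ _ (measurable_monomial i j)) mom.
- exists rho, (fun k => (x k, y k)); split => //; first exact: atom_mx_inj freeP.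
  by move=> A _; rewrite finite_atomicE.
move=> nu repnu [sigma [q [sigma_gt0 q_inj nuE]]] A mA.
(* [nu] agrees on measurable sets with a finite sum of weighted Dirac masses, so its moments are
   sums over its atoms. *)
have mom' : atomic_moments beta sigma (fun k => (q k).1) (fun k => (q k).2).
  move=> i j ij; apply: EFin_inj; rewrite (repnu i j ij).2.
  pose sigma' k := NngNum (ltW (sigma_gt0 k)).
  rewrite -(integral_finite_atomic sigma' q (measurable_monomial i j)).
  by apply: eq_measure_integral => B mB _; rewrite nuE // finite_atomicE.
have [f [f_bij sigmaE xE yE]] := atomic_moments_unique mom mom' rk.
(* The bijection [f] matches atoms and weights, so the two sums differ only by reindexing. *)
rewrite nuE // finite_atomicE [RHS](reindex f) /=; last exact: onW_bij.
by apply: eq_bigr => k _; rewrite sigmaE [q k]surjective_pairing xE yE.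
Qed.
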